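(* Let $R$ and $S$ be two loops (identity elements all denoted $\delta$), and let $\varphi:S\times R\to R$ be a map satisfying $\varphi(s,\delta)=\delta$ and $\varphi(\delta,r)=r$ for all $s\in S$, $r\in R$. Then a loop $Q$ is isomorphic to the loop $R\rtimes S:=R\times S$ with the multiplication given by $$(r,s)(r',s'):=(r\,\varphi(s,r'),\,ss')$$ if and only if there are quasigroup homomorphisms $i_S:S\to Q$, $i_R:R\to Q$, $p_S:Q\to S$, and a map $p_R:Q\to R$ satisfying the Moufang-type identities $$p_R\big((i_R(r)i_S(s))(i_R(r')i_S(s'))\big)=p_R(i_R(r))\Big(p_R(i_S(s)i_R(r'))\,p_R(i_S(s'))\Big)=\Big(p_R(i_R(r))\,p_R(i_S(s)i_R(r'))\Big)p_R(i_S(s'))$$ for all $r,r'\in R$ and $s,s'\in S$, as well as $p_R\circ i_R=\mathrm{Id}_R$ and $p_S\circ i_S=\mathrm{Id}_S$, such that the maps $R\rtimes S\to Q$, $(r,s)\mapsto i_R(r)i_S(s)$, and $Q\to R\rtimes S$, $q\mapsto(p_R(q),p_S(q))$, are inverse to each other.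
   Context: A quasigroup is a set $Q$ with a binary multiplication such that for all $a,b\in Q$ there are unique $x,y\in Q$ with $ax=b$ and $ya=b$. A loop is a quasigroup with an element $\delta$ such that $x\delta=\delta x=x$ for all $x$. A quasigroup homomorphism is a map $f$ with $f(xy)=f(x)f(y)$ for all $x,y$; an isomorphism is a bijective homomorphism.
   Formalization: For fixed φ the literal ''if'' is false (R=Z/3, S=Z/2, φ inversion, Q=Z/6), so φ(s,r)=p_R(i_S(s)i_R(r)) is added to the right-hand side; also proved: with no tie to φ, the maps exist iff Q is isomorphic to R⋊S for some admissible φ. *)

(* Defs.v *)
From HB Require Import structures.
From mathcomp Require Import all_boot.

Set Implicit Arguments.
Unset Strict Implicit.
Unset Printing Implicit Defensive.

Local Open Scope group_scope.

(* No choice structure is required, so that carriers are arbitrary types. *)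
HB.mixin Record Magma_isQuasigroup Q of Magma Q := {
  ldiv_unique : forall a b : Q, exists! x : Q, a * x = b;
  rdiv_unique : forall a b : Q, exists! y : Q, y * a = b
}.

#[short(type="quasigroupType")]
HB.structure Definition Quasigroup := {Q of Magma_isQuasigroup Q & Magma Q}.

(* MathComp's own unital magmas ([umagmaType]) would impose a choice structure
   on the carrier, hence a separate mixin for the unit laws; the identity
   element itself is MathComp's [1]. *)
HB.mixin Record BaseUMagma_isUnital Q of BaseUMagma Q := {
  unit_mull : forall x : Q, 1 * x = x;
  unit_mulr : forall x : Q, x * 1 = x
}.

#[short(type="loopType")]
HB.structure Definition Loop :=
  {Q of Quasigroup Q & hasOne Q & BaseUMagma_isUnital Q}.

Definition isomorphic (A B : magmaType) : Prop :=
  exists f : {multiplicative A -> B}, bijective f.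

(* The product R ><| S twisted by phi. It is in general only a magma: it is a
   quasigroup exactly when every [phi s] is bijective. For isomorphism with a
   loop this makes no difference, since being a loop is invariant under
   [isomorphic]. *)
Definition sdprod (R S : magmaType) (phi : S -> R -> R) : Type := (R * S)%type.

Section SdprodMul.
Variables (R S : magmaType) (phi : S -> R -> R).

Definition sdprod_mul (x y : sdprod phi) : sdprod phi :=
  (x.1 * phi x.2 y.1, x.2 * y.2).

HB.instance Definition _ := hasMul.Build (sdprod phi) sdprod_mul.
End SdprodMul.

Definition sdprod_datum (R S : loopType) (phi : S -> R -> R) : Prop :=
  (forall s, phi s 1 = 1) /\ (forall r, phi 1 r = r).

Section Splitting.
Variables (R S Q : loopType).
Variables (iS : S -> Q) (iR : R -> Q) (pS : Q -> S) (pR : Q -> R).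

Definition moufang_type : Prop :=
  forall (r r' : R) (s s' : S),
    pR ((iR r * iS s) * (iR r' * iS s'))
      = pR (iR r) * (pR (iS s * iR r') * pR (iS s'))
    /\ pR (iR r) * (pR (iS s * iR r') * pR (iS s'))
      = (pR (iR r) * pR (iS s * iR r')) * pR (iS s').

Definition splits : Prop :=
  [/\ moufang_type,
      (forall r, pR (iR r) = r),
      (forall s, pS (iS s) = s),
      cancel (fun x : R * S => iR x.1 * iS x.2) (fun q => (pR q, pS q))
    & cancel (fun q => (pR q, pS q)) (fun x : R * S => iR x.1 * iS x.2)].
End Splitting.

(* Main.v *)
(* An isomorphism g : R ><| S -> Q gives iR r = g (r, 1), iS s = g (1, s), and
   (pR, pS) = g^-1. Conversely, given the maps, put phi s r = pR (iS s * iR r).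
   Since iR 1 = 1, the pair (1, s) is sent to iS s, so pR (iS s) = 1; the
   Moufang-type identity at products (iR r * iS s) * (iR r' * iS s') then says
   exactly that (pR, pS) is multiplicative for the phi-twisted product. *)

Require Import Defs.
From HB Require Import structures.
From mathcomp Require Import all_boot.

Local Open Scope group_scope.

Lemma loop_mulgI {Q : loopType} (a : Q) : injective (fun x : Q => a * x).
Proof.
move=> x y /= e; have [z [_ uz]] := ldiv_unique a (a * x).
by rewrite -(uz x) // -(uz y).
Qed.

(** Cancel [f 1] on the left in [f 1 * f 1 = f 1 = f 1 * 1]. *)
Lemma loop_morph1 (A B : loopType) (f : {multiplicative A -> B}) : f 1 = 1.
Proof. by apply: (loop_mulgI (f 1)); rewrite /= -gmulfM !unit_mulr. Qed.

Definition mk_multiplicative {A B : magmaType} {f : A -> B}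
    (fM : {morph f : x y / x * y}) : {multiplicative A -> B} :=
  HB.pack f (isMultiplicative.Build A B f fM).

Section FromIsomorphism.
Context {R S Q : loopType} {phi : S -> R -> R}.

Lemma splits_of_isomorphic : sdprod_datum phi -> isomorphic Q (sdprod phi) ->
  exists (iS : {multiplicative S -> Q}) (iR : {multiplicative R -> Q})
         (pS : {multiplicative Q -> S}) (pR : Q -> R),
    splits iS iR pS pR /\ (forall s r, pR (iS s * iR r) = phi s r).
Proof.
case=> phi1r phi1l [f [g fK gK]].
have gM (r r' : R) (s s' : S) :
    g (r, s) * g (r', s') = g (r * phi s r', s * s').
  by apply: (can_inj fK); rewrite gmulfM !gK.
have iSM : {morph (fun s => g (1, s)) : s s' / s * s'}.
  by move=> s s'; rewrite gM phi1r unit_mulr.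
have iRM : {morph (fun r => g (r, 1)) : r r' / r * r'}.
  by move=> r r'; rewrite gM phi1l unit_mulr.
have pSM : {morph (fun q => (f q).2) : q q' / q * q'}.
  by move=> q q'; rewrite gmulfM.
exists (mk_multiplicative iSM), (mk_multiplicative iRM), (mk_multiplicative pSM).
exists (fun q => (f q).1).
(* The first component of the product is [r * phi 1 1], and [phi 1 1 = 1]. *)
have iRSE r s : g (r, 1) * g (1, s) = g (r, s).
  by rewrite gM phi1r unit_mulr unit_mull.
split=> [|s r] /=; last by rewrite gM gK /= unit_mull.
split=> /=.
(* All three expressions equal [r * phi s r'], since [pR (iS s') = 1]. *)
- by move=> r r' s s'; rewrite !iRSE !gM !gK /= !unit_mull !unit_mulr.
- by move=> r; rewrite gK.
- by move=> s; rewrite gK.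
- by case=> r s; rewrite iRSE gK.
- by move=> q; rewrite iRSE -surjective_pairing fK.
Qed.
End FromIsomorphism.

Section FromSplitting.
Context {R S Q : loopType}.
Context {iS : {multiplicative S -> Q}} {iR : {multiplicative R -> Q}}.
Context {pS : {multiplicative Q -> S}} {pR : Q -> R}.
Hypothesis spl : splits iS iR pS pR.

Lemma splits_pR_iS s : pR (iS s) = 1.
Proof.
have [_ _ _ /(_ (1, s)) /= + _] := spl.
by rewrite loop_morph1 unit_mull => -[].
Qed.

Lemma splits_sdprod_datum : sdprod_datum (fun s r => pR (iS s * iR r)).
Proof.
have [_ pRK _ _ _] := spl.
split=> [s|r]; first by rewrite loop_morph1 unit_mulr splits_pR_iS.
by rewrite loop_morph1 unit_mull pRK.
Qed.

(** Assuming only pointwise agreement with [phi] serves both a prescribed [phi] and the one read off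
    from the maps. *)
Lemma isomorphic_of_splits {phi : S -> R -> R} :
  (forall s r, pR (iS s * iR r) = phi s r) -> isomorphic Q (sdprod phi).
Proof.
move=> phiE; have [mouf pRK pSK iK pK] := spl.
pose f q : sdprod phi := (pR q, pS q).
have fM : {morph f : q q' / q * q'}.
  move=> q q'; rewrite {1}/f gmulfM; congr pair.
  (* Factoring [q] and [q'] as [iR (pR _) * iS (pS _)] on the left brings the product into the shape
     of the Moufang-type identity. *)
  rewrite -[q in LHS]pK -[q' in LHS]pK /=.
  by rewrite (mouf _ _ _ _).1 pRK phiE splits_pR_iS unit_mulr.
by exists (mk_multiplicative fM), (fun x : R * S => iR x.1 * iS x.2).
Qed.
End FromSplitting.

(** The maps determine their own twist, so for a fixed [phi] they must be required to recover it;
    when [phi] may vary, this requirement disappears. *)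
Theorem proposition2p6 (R S Q : loopType) :
  (forall phi : S -> R -> R, sdprod_datum phi ->
     (isomorphic Q (sdprod phi) <->
      exists (iS : {multiplicative S -> Q}) (iR : {multiplicative R -> Q})
             (pS : {multiplicative Q -> S}) (pR : Q -> R),
        splits iS iR pS pR /\
        (forall (s : S) (r : R), pR (iS s * iR r) = phi s r)))
  /\
  ((exists phi : S -> R -> R, sdprod_datum phi /\ isomorphic Q (sdprod phi)) <->
   exists (iS : {multiplicative S -> Q}) (iR : {multiplicative R -> Q})
          (pS : {multiplicative Q -> S}) (pR : Q -> R),
     splits iS iR pS pR).
Proof.
split=> [phi phiP|].
  split=> [|[iS [iR [pS [pR [spl phiE]]]]]]; first exact: splits_of_isomorphic.
  exact: (isomorphic_of_splits spl phiE).
split=> [[phi [phiP]]|[iS [iR [pS [pR spl]]]]].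
  move=> /(splits_of_isomorphic phiP)[iS [iR [pS [pR [spl _]]]]].
  by exists iS, iR, pS, pR.
exists (fun s r => pR (iS s * iR r)).
split; first exact: splits_sdprod_datum spl.
by apply: (isomorphic_of_splits spl).
Qed.
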